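(* Let $A$ be a complete discrete valuation ring in which $2$ is a unit, with maximal ideal $\mathfrak r$, whose residue field $A/\mathfrak r$ is quadratically closed. Let $*$ be an unramified involution of $A$, let $y$ be a fixed uniformiser of $A$ with $y^*=-y$, and fix a unit $b$ of $A$ with $b^*=-b$. Let $m>0$ and let $M\in M_m(A)$ be hermitian (resp. skew hermitian). Then $M$ is $*$-congruent to one and only one matrix of the form $\bigoplus_{i=0}^\infty y^iM_i$, where every $M_i$ of size $>0$ is equal to a diagonal matrix $\mathrm{diag}(1,\dots,1,-1,\dots,-1)$ (resp. $\mathrm{diag}(b,\dots,b,-b,\dots,-b)$).
   Context: An involution of $A$ is a ring automorphism $a\mapsto a^*$ of order at most two; it is unramified if the induced involution on $A/\mathfrak r$ is nontrivial (equivalently, some unit $b$ satisfies $b^*=-b$). A field is quadratically closed if it has no field extensions of degree 2. A uniformiser is a generator of $\mathfrak r$; since $*$ is nontrivial, a uniformiser with $y^*=-y$ exists. Complete means that $\bigcap_{i\ge1}\mathfrak r^i=0$ and $A$ is complete for its $\mathfrak r$-adic metric. A matrix $C\in M_m(A)$ is hermitian (resp. skew hermitian) if $C'^*=C$ (resp. $C'^*=-C$), where $C'$ is the transpose and $*$ is applied entrywise. Matrices $C,D\in M_m(A)$ are $*$-congruent if $D=X'^*CX$ for some $X\in GL_m(A)$. Convention: $y^\infty=0$, and $\bigoplus_{i=0}^\infty y^iM_i$ denotes a block diagonal $m\times m$ matrix $M_0\oplus yM_1\oplus y^2M_2\oplus\cdots\oplus y^\infty M_\infty$ in which all but finitely many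 blocks have size $0$; the last summand $y^\infty M_\infty$ is a zero block (possibly of size $0$), and the conditions on $M_i$ concern $0\le i<\infty$. In the diagonal matrices the number of $1$'s or of $-1$'s (resp. of $b$'s or of $-b$'s) may be zero.
   Formalization: Since y*=-y, the printed form fails for odd i (e.g. M=(yb), m=1); the formal statement takes M_i=diag(b,…,b,-b,…,-b) for odd i when M is hermitian, and M_i=diag(1,…,1,-1,…,-1) for odd i when M is skew hermitian; even i are as printed. *)

(* Defs.v *)
From HB Require Import structures.
From mathcomp Require Import all_boot all_order all_algebra all_field.

Set Implicit Arguments.
Unset Strict Implicit.
Unset Printing Implicit Defensive.

Import GRing.Theory.
Local Open Scope ring_scope.

(* Plain MathComp; ideals are Prop-valued predicates so that no decidability
   assumption is built into the hypotheses on the ring. *)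

Definition is_ideal (A : idomainType) (I : A -> Prop) : Prop :=
  [/\ I 0, forall x z, I x -> I z -> I (x + z) & forall a x, I x -> I (a * x)].

Definition generates (A : idomainType) (a : A) (I : A -> Prop) : Prop :=
  forall x, I x <-> exists c, x = c * a.

(* In a local ring the maximal ideal is the set of nonunits. *)
Definition maxideal (A : idomainType) (x : A) : Prop := x \isn't a GRing.unit.

(* Local principal ideal domain that is not a field. *)
Definition is_DVR (A : idomainType) : Prop :=
  [/\ forall I : A -> Prop, is_ideal I -> exists a, generates a I,
      is_ideal (@maxideal A)
    & exists2 x : A, maxideal x & x <> 0].

Definition uniformiser (A : idomainType) (y : A) : Prop :=
  generates y (@maxideal A).

(* The k-th power of the maximal ideal: A-linear combinations of products of
   k nonunits; it is the whole ring for k = 0. *)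
Definition maxideal_pow (A : idomainType) (k : nat) (x : A) : Prop :=
  exists2 s : seq (A * k.-tuple A),
    forall p, p \in s -> forall a, a \in p.2 -> maxideal a
    & x = \sum_(p <- s) p.1 * \prod_(a <- p.2) a.

Definition adic_cauchy (A : idomainType) (u : nat -> A) : Prop :=
  forall k, exists N, forall i j, (N <= i)%N -> (N <= j)%N ->
    maxideal_pow k (u i - u j).

Definition adic_limit (A : idomainType) (u : nat -> A) (l : A) : Prop :=
  forall k, exists N, forall i, (N <= i)%N -> maxideal_pow k (u i - l).

Definition adic_complete (A : idomainType) : Prop :=
  (forall x : A, (forall i, (1 <= i)%N -> maxideal_pow i x) -> x = 0) /\
  (forall u : nat -> A, adic_cauchy u -> exists l, adic_limit u l).

(* The residue field is given, up to unique isomorphism, as a surjection onto a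
   field whose kernel is the maximal ideal. *)
Definition residue_map (A : idomainType) (F : fieldType)
    (pi : {rmorphism A -> F}) : Prop :=
  (forall z, exists x, pi x = z) /\ (forall x, pi x = 0 <-> maxideal x).

Definition quadratically_closed (F : fieldType) : Prop :=
  forall L : fieldExtType F, \dim {:L} <> 2%N.

(* The involution induced on the residue field, pi x |-> pi (star x), is not
   the identity. *)
Definition unramified (A : idomainType) (F : fieldType)
    (pi : {rmorphism A -> F}) (star : {rmorphism A -> A}) : Prop :=
  exists x, pi (star x) <> pi x.

Definition conj_tr (A : idomainType) (star : {rmorphism A -> A}) (m n : nat)
    (C : 'M[A]_(m, n)) : 'M[A]_(n, m) := map_mx star C^T.

Definition hermitian_mx (A : idomainType) (star : {rmorphism A -> A}) (m : nat)
    (C : 'M[A]_m) : Prop := conj_tr star C = C.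

Definition skew_hermitian_mx (A : idomainType) (star : {rmorphism A -> A})
    (m : nat) (C : 'M[A]_m) : Prop := conj_tr star C = - C.

Definition star_congruent (A : idomainType) (star : {rmorphism A -> A})
    (m : nat) (C D : 'M[A]_m) : Prop :=
  exists2 X : 'M[A]_m, X \in unitmx & D = conj_tr star X *m C *m X.

(* diag(c, ..., c, -c, ..., -c) with p entries c and q entries -c. *)
Definition pm_diag (A : idomainType) (c : A) (p q : nat) : 'M[A]_(p + q) :=
  block_mx c%:M 0 0 (- c)%:M.

(* N = M_0 (+) y M_1 (+) ... (+) y^(k-1) M_(k-1) (+) 0, where M_i is
   diag(c i, ..., c i, - c i, ..., - c i), possibly of size 0, and the last
   summand is a zero block of size z, possibly 0. The bound k is arbitrary. *)
Definition diagonal_form (A : idomainType) (y : A) (c : nat -> A) (m : nat)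
    (N : 'M[A]_m) : Prop :=
  exists (k : nat) (p q : 'I_k -> nat) (z : nat)
         (e : ((\sum_(i < k) (p i + q i)) + z)%N = m),
    N = castmx (e, e)
          (block_mx (\mxdiag_(i < k) (y ^+ i *: pm_diag (c i) (p i) (q i)))
                    0 0 (0 : 'M[A]_z)).

(* As y is skew, y^i M_i has the same type (hermitian or skew hermitian) as M_i
   for i even and the opposite type for i odd. So in a normal form for hermitian
   matrices M_i has entries 1, -1 for i even and b, -b for i odd, and the other
   way round for skew hermitian matrices. *)
Definition hermitian_scalar (A : idomainType) (b : A) (i : nat) : A :=
  if odd i then b else 1.

Definition skew_hermitian_scalar (A : idomainType) (b : A) (i : nat) : A :=
  if odd i then 1 else b.

(* Main.v *)
Require Import Defs.
From HB Require Import structures.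
From mathcomp Require Import all_boot all_order all_algebra all_field.
From mathcomp Require Import perm zify ring.
From Stdlib Require Import Classical.

Set Implicit Arguments.
Unset Strict Implicit.
Unset Printing Implicit Defensive.

Import GRing.Theory.
Local Open Scope ring_scope.

(* Let [F] be the residue field. As every element of [F] is a square, every
   symmetric element of [F] is plus or minus a norm [z z^*]; by completeness this
   lifts to symmetric units of [A]. So a hermitian matrix, after taking out the
   largest power of [y] and a unit that is symmetric or skew, splits off an entry
   1 or -1, and induction gives a diagonal form.
   For uniqueness, -1 is the square of some [w] with [w^* = - w] in [F], so a sum
   of two norms, which are squares of symmetric elements, is again a norm
   [s ^ 2 + t ^ 2 = (s + w t) (s + w t)^*], and it vanishes only trivially. Thus
   Sylvester's law of inertia holds over [F], and it gives the multiplicity of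
   each nonzero diagonal entry. *)

(** If [z] had no square root, [X^2 - z] would be a quadratic without roots, hence irreducible, and
    adjoining a root would give an extension of degree 2. *)
Lemma quadratically_closed_sqrt (F : fieldType) :
  quadratically_closed F -> forall z : F, exists w, w ^+ 2 = z.
Proof.
move=> hF z; apply: NNPP => nw.
have sz : size ('X^2 - z%:P : {poly F}) = 3%N by rewrite size_XnsubC.
have irr : irreducible_poly ('X^2 - z%:P : {poly F}).
  apply: cubic_irreducible => [|w]; first by rewrite sz.
  apply/negP; rewrite /root !hornerE subr_eq0 => /eqP h.
  by apply: nw; exists w.
have [L dimL _] := irredp_FAdjoin irr.
by apply: (hF L); rewrite dimL sz.
Qed.

(** * Divisibility by powers of the uniformiser *)

Section HermitianForms.

Variables (A : idomainType) (y : A).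
Hypotheses (hDVR : is_DVR A) (hy : uniformiser y).

Definition pow_dvd (k : nat) (x : A) : Prop := exists c, x = c * y ^+ k.

Lemma uniformiser_nonunit : y \isn't a GRing.unit.
Proof. by apply/hy; exists 1; rewrite mul1r. Qed.

Lemma nonunit_mulr (x : A) : x \isn't a GRing.unit -> exists c, x = c * y.
Proof. by move/hy. Qed.

Lemma uniformiser_neq0 : y != 0.
Proof.
apply/eqP => y0; case: hDVR => _ _ [x /nonunit_mulr[c ->]].
by rewrite y0 mulr0.
Qed.

Lemma expy_neq0 k : y ^+ k != 0.
Proof. by rewrite expf_neq0 // uniformiser_neq0. Qed.

Lemma pow_dvd0 k : pow_dvd k 0.
Proof. by exists 0; rewrite mul0r. Qed.

Lemma pow_dvdD k x z : pow_dvd k x -> pow_dvd k z -> pow_dvd k (x + z).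
Proof. by move=> [c ->] [d ->]; exists (c + d); rewrite mulrDl. Qed.

Lemma pow_dvdM k a x : pow_dvd k x -> pow_dvd k (a * x).
Proof. by move=> [c ->]; exists (a * c); rewrite mulrA. Qed.

Lemma pow_dvdN k x : pow_dvd k x -> pow_dvd k (- x).
Proof. by move=> [c ->]; exists (- c); rewrite mulNr. Qed.

Lemma pow_dvd_leq k l x : (k <= l)%N -> pow_dvd l x -> pow_dvd k x.
Proof.
by move=> /subnK<- [c ->]; exists (c * y ^+ (l - k)); rewrite -mulrA -exprD.
Qed.

Lemma pow_dvd1 x : pow_dvd 1 x <-> x \isn't a GRing.unit.
Proof. by split=> [[c xE]|/nonunit_mulr//]; apply/hy; exists c. Qed.

(** Each of the [k] nonunit factors of a product supplies one factor [y]. This turns Cauchy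
    sequences and limits into statements on divisibility. *)
Lemma maxideal_powP k x : maxideal_pow k x <-> pow_dvd k x.
Proof.
split=> [[s hs ->]|[c ->]]; last first.
  exists [:: (c, nseq_tuple k y)] => [p|].
    rewrite inE => /eqP-> a /= /nseqP[-> _]; exact: uniformiser_nonunit.
  by rewrite big_seq1 /= big_nseq -Monoid.iteropE.
rewrite big_seq; apply: (big_ind (pow_dvd k)) => [||p /hs hp].
- exact: pow_dvd0.
- exact: pow_dvdD.
apply: pow_dvdM; case: p hp => _ [t /= tk] hp.
have {hp}: {in t, forall a, a \isn't a GRing.unit} := hp.
move/eqP: tk => <-; elim: t => [_|a t IH ht]; first by exists 1; rewrite big_nil mul1r.
rewrite big_cons; have [|c ->] := IH.
  by move=> z zt; apply: ht; rewrite inE zt orbT.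
have /nonunit_mulr[d ->] : a \isn't a GRing.unit by apply: ht; rewrite mem_head.
by exists (d * c); rewrite exprS; ring.
Qed.

(** * Completeness and limits *)

Hypothesis hcomplete : adic_complete A.

Lemma pow_dvd_eq0 x : (forall k, pow_dvd k x) -> x = 0.
Proof. by move=> hx; apply: hcomplete.1 => k _; apply/maxideal_powP. Qed.

Lemma ex_not_pow_dvd x : x != 0 -> exists k, ~ pow_dvd k x.
Proof.
move=> /eqP x0; apply: NNPP => h; apply/x0/pow_dvd_eq0 => k.
by apply: NNPP => hk; apply: h; exists k.
Qed.

(** The differences telescope, so [u i] is congruent to every later term modulo [y ^+ i]; comparison
    with a term far enough out gives the same congruence for the limit. *)
Lemma pow_dvd_limit (u : nat -> A) :
    (forall i, pow_dvd i (u i.+1 - u i)) ->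
  exists l, forall i, pow_dvd i (u i - l).
Proof.
move=> hu.
have step k i d : (k <= i)%N -> pow_dvd k (u (i + d)%N - u i).
  move=> ki; elim: d => [|d IH]; first by rewrite addn0 subrr; apply: pow_dvd0.
  rewrite addnS -(subrKA (u (i + d)%N)); apply: pow_dvdD => //.
  by apply: pow_dvd_leq (hu _); rewrite (leq_trans ki) ?leq_addr.
have cau : adic_cauchy u.
  move=> k; exists k => i j ki kj; apply/maxideal_powP.
  rewrite -(subrKA (u k)); apply: pow_dvdD.
    by rewrite -(subnKC ki); apply: step.
  by rewrite -opprB; apply: pow_dvdN; rewrite -(subnKC kj); apply: step.
have [l hl] := hcomplete.2 u cau; exists l => i.
have [N hN] := hl i.
have /maxideal_powP := hN (i + N)%N (leq_addl _ _) => h.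
rewrite -(subrKA (u (i + N)%N)); apply: pow_dvdD => //.
by rewrite -opprB; apply: pow_dvdN; apply: step.
Qed.

(** * Square roots and norms in the residue field, and their lifts *)

Variables (F : fieldType) (pi : {rmorphism A -> F}) (star : {rmorphism A -> A}).
Hypotheses (h2 : (2%:R : A) \is a GRing.unit) (hpi : residue_map pi).
Hypotheses (hF : quadratically_closed F) (hstar : involutive star).
Hypotheses (hystar : star y = - y).
Variable b : A.
Hypotheses (hb : b \is a GRing.unit) (hbstar : star b = - b).

Lemma residue_surj z : exists x, pi x = z.
Proof. exact: hpi.1. Qed.

Lemma residue_unit x : (x \is a GRing.unit) = (pi x != 0).
Proof.
apply/idP/idP => [ux|]; first by rewrite -unitfE rmorph_unit.
by apply: contraNT => nx; apply/eqP/hpi.2.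
Qed.

Lemma residue_eq0 x : pi x = 0 <-> x \isn't a GRing.unit.
Proof. exact: hpi.2. Qed.

Lemma star_unit x : (star x \is a GRing.unit) = (x \is a GRing.unit).
Proof.
apply/idP/idP => ux; last exact: rmorph_unit.
by rewrite -(hstar x) rmorph_unit.
Qed.

Lemma residue_star x z : pi x = pi z -> pi (star x) = pi (star z).
Proof.
move=> /eqP; rewrite -subr_eq0 -rmorphB => /eqP /residue_eq0 h.
apply/eqP; rewrite -subr_eq0 -!rmorphB; apply/eqP/residue_eq0.
by rewrite star_unit.
Qed.

Lemma residue_sqrt x : exists z, pi (z * z) = pi x.
Proof.
have [w hw] := quadratically_closed_sqrt hF (pi x).
by have [z zw] := residue_surj w; exists z; rewrite rmorphM zw -expr2.
Qed.

Lemma residue_2neq0 : (2%:R : F) != 0.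
Proof. by rewrite -(rmorph_nat pi) -residue_unit. Qed.

Lemma eqr_sqr_residue x z :
  pi (x * x) = pi (z * z) -> pi x = pi z \/ pi x = - pi z.
Proof.
rewrite !rmorphM -!expr2 => /eqP; rewrite eqf_sqr => /orP[] /eqP; by [left|right].
Qed.

Lemma pow_dvd_star k x : pow_dvd k x -> pow_dvd k (star x).
Proof.
move=> [c ->]; rewrite rmorphM rmorphXn hystar exprNn mulrA.
by exists (star c * (-1) ^+ k).
Qed.

(* Newton's iteration for the square root, with the factor [1 / (2 u)] replaced
   by [1 / 2], which is enough as [u = 1] modulo [y]. *)
Lemma sqrt_one_plus r : r \isn't a GRing.unit -> star r = r ->
  exists s, [/\ s \is a GRing.unit, star s = s & s * s = 1 + r].
Proof.
move=> nr sr; pose h : A := 2%:R^-1.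
have hE : h * 2%:R = 1 by rewrite mulVr.
have sh : star h = h by rewrite /h rmorphV // rmorph_nat.
pose u := fix u n := if n is n'.+1 then u n' - h * (u n' * u n' - (1 + r)) else 1.
have uS n : u n.+1 = u n - h * (u n * u n - (1 + r)) by [].
have su n : star (u n) = u n.
  elim: n => [|n IH]; first exact: rmorph1.
  by rewrite uS !(rmorphB, rmorphM, rmorphD) rmorph1 IH sh sr.
have hu n : pow_dvd 1 (u n - 1) /\ pow_dvd n.+1 (u n * u n - (1 + r)).
  elim: n => [|n [IH1 IH2]].
    split; first by rewrite subrr; apply: pow_dvd0.
    rewrite (_ : _ - _ = - r); last by rewrite /=; ring.
    exact/pow_dvdN/pow_dvd1.
  split.
    rewrite uS (_ : _ - _ = (u n - 1) + - h * (u n * u n - (1 + r))); last ring.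
    by apply: pow_dvdD => //; apply: pow_dvdM; apply: pow_dvd_leq IH2.
  (* As [2 h = 1], the new error is the old error [f] times [- (u n - 1) + h ^ 2 f], which is
     divisible by [y]; so each step gains one power of [y]. *)
  set f := u n * u n - (1 + r) in IH2 uS *.
  have -> : u n.+1 * u n.+1 - (1 + r) =
      (- (u n - 1) + h * h * f) * f.
    rewrite uS -/f.
    have fE : u n * u n = f + (1 + r) by rewrite /f subrK.
    transitivity (f - (h * 2%:R) * u n * f + h * h * f * f); first ring: fE.
    by rewrite hE; ring.
  case: IH2 IH1 => d -> [e ->].
  by exists ((- e + h * h * d * y ^+ n) * d); rewrite [y ^+ n.+2]exprS !exprS; ring.
have [|s hs] := @pow_dvd_limit u.
  move=> i; rewrite uS (_ : _ - _ = - h * (u i * u i - (1 + r))); last ring.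
  by apply: pow_dvdM; apply: pow_dvd_leq (hu i).2.
have ss : star s = s.
  apply/eqP; rewrite -subr_eq0; apply/eqP/pow_dvd_eq0 => k.
  rewrite (_ : _ - _ = - star (u k - s) + (u k - s)); last by rewrite rmorphB su; ring.
  by apply: pow_dvdD => //; apply/pow_dvdN/pow_dvd_star.
have s2 : s * s = 1 + r.
  apply/eqP; rewrite -subr_eq0; apply/eqP/pow_dvd_eq0 => k.
  rewrite (_ : _ - _ = (u k * u k - (1 + r)) + (- u k - s) * (u k - s)); last ring.
  by apply: pow_dvdD; [apply: pow_dvd_leq (hu k).2 | apply: pow_dvdM].
exists s; split=> //.
have : s * s \is a GRing.unit.
  rewrite s2 residue_unit rmorphD rmorph1.
  by have /residue_eq0-> := nr; rewrite addr0 oner_neq0.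
by rewrite unitrM => /andP[].
Qed.

(** Modulo [y], write [x = z ^ 2]. Symmetry of [x] gives [z^* ^ 2 = z ^ 2], so [z^* = +- z] and
    [x = +- z z^*]. *)
Lemma residue_norm x : star x = x ->
  exists z, pi x = pi (z * star z) \/ pi x = - pi (z * star z).
Proof.
move=> sx; have [z hz] := residue_sqrt x; exists z.
have /eqr_sqr_residue[] : pi (star z * star z) = pi (z * z).
- by rewrite hz -{1}sx -rmorphM; apply: residue_star.
- by move=> h; left; rewrite -hz !rmorphM h.
- by move=> h; right; rewrite -hz !rmorphM h mulrN opprK.
Qed.

(** The quotient of [x] by the signed norm from [residue_norm] is symmetric and 1 modulo [y]. It is
    thus [s ^ 2] with [s] symmetric, that is, the norm of [s], and [z s] replaces [z]. *)
Lemma unit_norm x : x \is a GRing.unit -> star x = x ->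
  exists2 z, z \is a GRing.unit & x = z * star z \/ x = - (z * star z).
Proof.
move=> ux sx; have [z hz] := residue_norm sx.
have [e e2 [se hez]] : exists2 e : A, e * e = 1 &
    star e = e /\ pi x = pi (e * (z * star z)).
  case: hz => hz; [exists 1|exists (-1)]; rewrite ?mulr1 ?mulN1r ?opprK //.
    by rewrite rmorph1 mul1r.
  by rewrite rmorphN rmorph1 rmorphN.
pose n := e * (z * star z).
have un : n \is a GRing.unit by rewrite residue_unit -hez -residue_unit.
have sn : star n = n by rewrite /n !rmorphM se hstar [star z * z]mulrC.
pose r := x / n - 1.
have nr : r \isn't a GRing.unit.
  apply/residue_eq0; rewrite rmorphB rmorphM rmorphV // rmorph1 hez divff ?subrr //.
  by rewrite -residue_unit.
have sr : star r = r by rewrite rmorphB rmorphM rmorphV // rmorph1 sx sn.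
have [s [us ss s2]] := sqrt_one_plus nr sr.
have xE : x = e * (z * s * star (z * s)).
  have -> : x = n * (1 + r) by rewrite /r addrC subrK mulrC divrK.
  by rewrite -s2 rmorphM ss /n; ring.
exists (z * s).
  move: ux; rewrite xE unitrM => /andP[_].
  by rewrite unitrM => /andP[].
have : e ^+ 2 == 1 by rewrite expr2 e2.
rewrite -subr_eq0 subr_sqr_1 mulf_eq0 subr_eq0 addr_eq0.
by rewrite xE => /orP[] /eqP->; [left; rewrite mul1r|right; rewrite mulN1r].
Qed.

(* If [w ^ 2 = -1] and [z ^ 2 = b] in the residue field, then [z^* = +- w z]
   because [b^* = - b]; hence [z = z^** = +- w^* z^* = w^* w z], so that
   [w w^* = 1 = - w ^ 2]. *)
Lemma residue_sqrtN1 : exists w, pi (w * w) = -1 /\ pi (star w) = - pi w.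
Proof.
have [w] := residue_sqrt (-1); rewrite rmorphN rmorph1 => w2.
exists w; split=> //.
have w0 : pi w != 0.
  apply/eqP => h; move: w2; rewrite rmorphM h mul0r => /eqP.
  by rewrite eq_sym oppr_eq0 oner_eq0.
have [z z2] := residue_sqrt b.
have z0 : pi z != 0.
  apply: contraTneq hb => h; rewrite residue_unit -z2 rmorphM h mul0r.
  by rewrite eqxx.
have hz : pi (star z * star z) = pi ((w * z) * (w * z)).
  rewrite -rmorphM (residue_star z2) hbstar rmorphN -z2 -mulN1r -w2 -rmorphM.
  by congr (pi _); ring.
have ww : pi w * pi (star w) = 1.
  have /eqr_sqr_residue[] := hz.
    move=> h; have := residue_star h; rewrite hstar !rmorphM h rmorphM.
    move=> /eqP; rewrite mulrA -{1}[pi z]mul1r (inj_eq (mulIf z0)) => /eqP->.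
    by rewrite mulrC.
  rewrite -rmorphN => h; have := residue_star h.
  rewrite hstar !(rmorphN, rmorphM) /= h !(rmorphN, rmorphM) mulrN opprK.
  move=> /eqP; rewrite mulrA -{1}[pi z]mul1r (inj_eq (mulIf z0)) => /eqP->.
  by rewrite mulrC.
apply: (mulfI w0); rewrite ww mulrN -rmorphM w2 opprK //.
Qed.

(** If [x = w ^ 2] modulo [y], then [x x^*] is the square of the symmetric element [w w^*]. *)
Lemma residue_norm_sqr x :
  exists t, [/\ pi (star t) = pi t, pi (t * t) = pi (x * star x) &
                pi t = 0 -> pi x = 0].
Proof.
have [w hw] := residue_sqrt x; exists (w * star w); split.
- by congr (pi _); rewrite rmorphM hstar mulrC.
- rewrite [RHS]rmorphM -(residue_star hw) -hw -rmorphM; congr (pi _).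
  by rewrite rmorphM; ring.
- move=> /eqP; rewrite rmorphM mulf_eq0 => h; rewrite -hw.
  suff pw : pi w = 0 by rewrite rmorphM pw mul0r.
  case/orP: h => /eqP // /residue_eq0 h; apply/residue_eq0.
  by rewrite -star_unit.
Qed.

(* With [w^* = - w] and [w ^ 2 = -1], and [s], [t] symmetric,
   [s ^ 2 + t ^ 2 = (s + w t) (s + w t)^*]. *)
Lemma residue_norm_add x z :
  exists u, pi (x * star x) + pi (z * star z) = pi (u * star u) /\
            (pi u = 0 -> pi x = 0 /\ pi z = 0).
Proof.
have [w [w2 sw]] := residue_sqrtN1.
have [s [ss s2 s0]] := residue_norm_sqr x.
have [t [st t2 t0]] := residue_norm_sqr z.
have su : pi (star (s + w * t)) = pi s - pi w * pi t.
  by rewrite !(rmorphD, rmorphM) ss st sw mulNr.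
exists (s + w * t); split.
  rewrite -s2 -t2 [RHS]rmorphM su rmorphD !rmorphM -[X in _ + X]opprK -mulN1r.
  by rewrite -w2 rmorphM; ring.
move=> u0.
have u0' : pi (star (s + w * t)) = 0.
  by rewrite (@residue_star _ 0) ?rmorph0 // u0 rmorph0.
(* The sum of [s + w t] and its conjugate [s - w t], both zero in the residue field, is [2 s]. *)
have ps : pi s = 0.
  have : 2%:R * pi s = 0.
    by rewrite -(addr0 0) -{1}u0 -u0' su rmorphD rmorphM; ring.
  by move/eqP; rewrite mulf_eq0 (negbTE residue_2neq0) => /eqP.
split; first exact: s0.
apply: t0; move/eqP: u0; rewrite rmorphD rmorphM ps add0r mulf_eq0.
case/orP=> /eqP // pw; move: w2; rewrite rmorphM pw mul0r => /eqP.
by rewrite eq_sym oppr_eq0 oner_eq0.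
Qed.

(** Anisotropy of sums of norms: [residue_norm_add] collapses the sum to a single norm [u u^*],
    where [u] vanishes modulo [y] only if all the [x i] do. *)
Lemma residue_norm_sum_eq0 (I : eqType) (r : seq I) (x : I -> A) :
    \sum_(i <- r) pi (x i * star (x i)) = 0 ->
  forall i, i \in r -> pi (x i) = 0.
Proof.
have [u [uE hu]] : exists u,
    \sum_(i <- r) pi (x i * star (x i)) = pi (u * star u) /\
    (pi u = 0 -> forall i, i \in r -> pi (x i) = 0).
  elim: r => [|i r [u [uE hu]]].
    by exists 0; split=> //; rewrite big_nil mul0r rmorph0.
  have [v [vE hv]] := residue_norm_add (x i) u.
  exists v; split; first by rewrite big_cons uE.
  move=> /hv[xi /hu hr] j; rewrite inE => /orP[/eqP->//|]; exact: hr.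
rewrite uE => /residue_eq0; rewrite unitrM star_unit andbb => h.
by apply: hu; apply/residue_eq0.
Qed.

(** * Conjugate transposes and congruence *)

Local Notation "A ^*t" := (conj_tr star A) (at level 8, format "A ^*t").
Local Notation "M =~ N" := (star_congruent star M N) (at level 70).

Lemma conj_trM m n p (B : 'M_(m, n)) (C : 'M_(n, p)) :
  (B *m C)^*t = C^*t *m B^*t.
Proof. by rewrite /conj_tr trmx_mul map_mxM. Qed.

Lemma conj_trK m n (B : 'M_(m, n)) : B^*t^*t = B.
Proof. by apply/matrixP => i j; rewrite !mxE hstar. Qed.

Lemma conj_trZ m n a (B : 'M_(m, n)) : (a *: B)^*t = star a *: B^*t.
Proof. by apply/matrixP => i j; rewrite !mxE rmorphM. Qed.

Lemma conj_trD m n (B C : 'M_(m, n)) : (B + C)^*t = B^*t + C^*t.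
Proof. by apply/matrixP => i j; rewrite !mxE rmorphD. Qed.

Lemma conj_tr_scalar n (a : A) : (a%:M)^*t = (star a)%:M :> 'M_n.
Proof. by rewrite /conj_tr tr_scalar_mx map_scalar_mx. Qed.

Lemma conj_tr_block m1 m2 n1 n2 (Bul : 'M_(m1, n1)) (Bur : 'M_(m1, n2))
    (Bdl : 'M_(m2, n1)) (Bdr : 'M_(m2, n2)) :
  (block_mx Bul Bur Bdl Bdr)^*t = block_mx Bul^*t Bdl^*t Bur^*t Bdr^*t.
Proof. by rewrite /conj_tr tr_block_mx map_block_mx. Qed.

Lemma conj_tr0 m n : (0 : 'M_(m, n))^*t = 0.
Proof. by rewrite /conj_tr trmx0 map_mx0. Qed.

Lemma star_congruent_refl n (M : 'M_n) : M =~ M.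
Proof.
by exists 1%:M; rewrite ?unitmx1 // conj_tr_scalar rmorph1 mulmx1 mul1mx.
Qed.

Lemma star_congruent_trans n (M N P : 'M_n) : M =~ N -> N =~ P -> M =~ P.
Proof.
move=> [X uX ->] [Y uY ->]; exists (X *m Y); first by rewrite unitmx_mul uX.
by rewrite conj_trM !mulmxA.
Qed.

Lemma star_congruent_sym n (M N : 'M_n) : M =~ N -> N =~ M.
Proof.
move=> [X uX ->]; exists (invmx X); first by rewrite unitmx_inv.
rewrite -!mulmxA mulmxV // mulmx1 mulmxA -conj_trM mulmxV //.
by rewrite conj_tr_scalar rmorph1 mul1mx.
Qed.

Lemma star_congruentZ n a (M N : 'M_n) : M =~ N -> a *: M =~ a *: N.
Proof.
by move=> [X uX ->]; exists X => //; rewrite -scalemxAr -scalemxAl.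
Qed.

Lemma star_congruent_block m n (B : 'M_m) (M N : 'M_n) :
  M =~ N -> block_mx B 0 0 M =~ block_mx B 0 0 N.
Proof.
move=> [X uX ->]; exists (block_mx 1%:M 0 0 X).
  by rewrite unitmxE det_ublock det1 mul1r.
rewrite conj_tr_block !conj_tr0 conj_tr_scalar rmorph1 !mulmx_block.
by rewrite !(mul0mx, mulmx0, mulmx1, mul1mx, addr0, add0r).
Qed.

Lemma star_congruent_hermitian n (M N : 'M_n) : M =~ N -> M^*t = M -> N^*t = N.
Proof. by move=> [X _ ->] hM; rewrite !conj_trM conj_trK hM mulmxA. Qed.

(** * Splitting off an entry 1 or -1 from a hermitian matrix *)

Lemma mul_delta_mxE n (i j : 'I_n) (H : 'M[A]_n) k l :
  (delta_mx i j *m H) k l = H j l *+ (k == i).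
Proof.
rewrite mxE (bigD1 j) //= big1 ?addr0 => [|a aj]; rewrite mxE.
  by rewrite eqxx andbT mulr_natl.
by rewrite (negbTE aj) andbF mul0r.
Qed.

Lemma mul_mx_deltaE n (i j : 'I_n) (H : 'M[A]_n) k l :
  (H *m delta_mx i j) k l = H k i *+ (l == j).
Proof.
rewrite mxE (bigD1 i) //= big1 ?addr0 => [|a ai]; rewrite mxE.
  by rewrite eqxx mulr_natr.
by rewrite (negbTE ai) mulr0.
Qed.

(* If all diagonal entries are nonunits, then [e_i + a e_j] with [a = 1 / H i j]
   has norm [2] modulo [y] for [H]. *)
Lemma hermitian_unit_diag n (H : 'M_n) i j :
    H^*t = H -> H i j \is a GRing.unit ->
  exists2 N : 'M_n, H =~ N & exists k, N k k \is a GRing.unit.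
Proof.
move=> hH uij; have [[k uk]|nu] := classic (exists k, H k k \is a GRing.unit).
  by exists H; [apply: star_congruent_refl | exists k].
have nd k : pi (H k k) = 0.
  by apply/residue_eq0/negP => uk; apply: nu; exists k.
have ij : i != j.
  by apply/negP => /eqP ij; apply: nu; exists i; rewrite {2}ij.
pose a := (H i j)^-1; pose X : 'M_n := 1%:M + a *: delta_mx j i.
have uX : X \in unitmx.
  suff /mulmx1_unit[] : X *m (1%:M - a *: delta_mx j i) = 1%:M by [].
  rewrite mulmxDl mul1mx mulmxBr mulmx1 -scalemxAl -scalemxAr.
  by rewrite mul_delta_mx_0 // !scaler0 subr0 subrK.
have Hji : H j i = star (H i j) by rewrite -{1}hH !mxE.
exists (X^*t *m H *m X); [by exists X | exists i].
have -> : X^*t = 1%:M + star a *: delta_mx i j.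
  rewrite conj_trD conj_trZ conj_tr_scalar rmorph1; congr (_ + _ *: _).
  by apply/matrixP => k l; rewrite !mxE rmorph_nat andbC.
rewrite mulmxDl mul1mx mulmxDr mulmx1 -scalemxAl -scalemxAr.
have DE (B C : 'M[A]_n) k l : (B + C) k l = B k l + C k l by rewrite mxE.
have ZE r (B : 'M[A]_n) k l : (r *: B) k l = r * B k l by rewrite mxE.
rewrite !(DE, ZE, mul_delta_mxE, mul_mx_deltaE) !eqxx !mulr1n Hji /a rmorphV //.
rewrite mulVr ?star_unit // mulrDr mulVr // residue_unit.
by rewrite !(rmorphD, rmorphM) /= !nd !mulr0 rmorph1 add0r addr0 residue_2neq0.
Qed.

(** A transposition moves a unit diagonal entry [a] to the corner. With [a = +- z z^*], scaling by
    [z^-1] makes it 1 or -1; clearing its row and column leaves the Schur complement [H']. *)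
Lemma hermitian_split n (H : 'M_(1 + n)) i j :
    H^*t = H -> H i j \is a GRing.unit ->
  exists (e : bool) (H' : 'M_n), H'^*t = H' /\
    H =~ block_mx ((-1) ^+ e)%:M 0 0 H'.
Proof.
move=> hH uij; have [H1 HH1 [k ukk]] := hermitian_unit_diag hH uij.
have [G [HG hG uG]] : exists G : 'M_(1 + n),
    [/\ H =~ G, G^*t = G & G 0 0 \is a GRing.unit].
  pose G := (tperm_mx 0 k)^*t *m H1 *m tperm_mx 0 k.
  have HG : H =~ G.
    apply: star_congruent_trans HH1 _.
    by exists (tperm_mx 0 k); rewrite ?unitmx_perm.
  exists G; split=> //; first exact: star_congruent_hermitian hH.
  rewrite /G /conj_tr tr_tperm_mx map_tperm_mx -xcolE -xrowE.
  by rewrite !mxE tpermL.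
pose a := G 0 0; pose u := ursubmx G; pose D := drsubmx G.
have sa : star a = a by rewrite /a -{2}hG !mxE.
have GE : G = block_mx a%:M u u^*t D.
  rewrite -[LHS]submxK; congr block_mx.
    by rewrite [LHS]mx11_scalar !mxE !lshift0.
  by rewrite -[in LHS]hG; apply/matrixP => p q; rewrite !mxE.
have [z uz zE] := unit_norm uG sa.
pose X : 'M_(1 + n) := block_mx (z^-1)%:M (- (a^-1 *: u)) 0 1%:M.
have uX : X \in unitmx by rewrite unitmxE det_ublock det_scalar1 det1 mulr1 unitrV.
pose H' := D - a^-1 *: (u^*t *m u).
have [e eE] : exists e : bool, a = (-1) ^+ e * (z * star z).
  by case: zE => zE; [exists false; rewrite mul1r | exists true; rewrite mulN1r].
have GN : G =~ block_mx ((-1) ^+ e)%:M 0 0 H'.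
  exists X => //; rewrite GE /X conj_tr_block conj_tr0 !conj_tr_scalar rmorph1.
  rewrite !mulmx_block !(mul0mx, mulmx0, mulmx1, mul1mx, addr0, add0r).
  rewrite !mul_scalar_mx !mul_mx_scalar.
  have sV : star a^-1 = a^-1 by rewrite rmorphV // sa.
  have -> : (- (a^-1 *: u))^*t = - (a^-1 *: u^*t).
    by rewrite -!scaleN1r !conj_trZ rmorphN rmorph1 sV.
  rewrite !scalerN !scalerA mulrV // scale1r addNr scaler0.
  have uz' : star z \is a GRing.unit by rewrite star_unit.
  congr block_mx.
  - rewrite scale_scalar_mx eE rmorphV // mulrCA mulrACA !mulVr //.
    by rewrite !mulr1.
  - rewrite mulmxN scale_scalar_mx mul_scalar_mx scalerA -mulrA mulrV // mulr1.
    by rewrite addNr.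
  - by rewrite mul0mx add0r mulNmx -scalemxAl addrC.
exists e, H'; split.
  have := star_congruent_hermitian GN hG; rewrite conj_tr_block.
  by move=> /eq_block_mx[].
exact: star_congruent_trans HG GN.
Qed.

(** * Existence of a diagonal form *)

Variables (c : nat -> A) (eta : A).
Hypotheses (hc : forall i, c i \is a GRing.unit) (heta : eta * eta = 1).
(** As [y^* = - y], this says that [x = y ^+ i * c i] satisfies [x^* = eta x]. The values 1 and -1
    of [eta] give the hermitian and the skew hermitian case. *)
Hypothesis hcstar : forall i, star (c i) = eta * (-1) ^+ i * c i.

(* [Some i.*2] and [Some i.*2.+1] encode the entries [y ^+ i * c i] and
   [- (y ^+ i * c i)], and [None] encodes the entry 0. *)
Definition code_val (o : option nat) : A :=
  if o is Some n then (-1) ^+ odd n * (y ^+ n./2 * c n./2) else 0.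

Definition code_mx m (t : seq (option nat)) : 'M[A]_m :=
  diag_mx (\row_(j < m) code_val (nth None t j)).

Lemma code_mxE m t i j :
  code_mx m t i j = code_val (nth None t i) *+ (i == j).
Proof. by rewrite !mxE. Qed.

Lemma code_mx_cat m n s t : size s = m ->
  code_mx (m + n) (s ++ t) = block_mx (code_mx m s) 0 0 (code_mx n t).
Proof.
move=> sm; apply/matrixP => i j; rewrite code_mxE nth_cat sm.
case: (split_ordP i) => k ->; case: (split_ordP j) => l ->.
- by rewrite block_mxEul code_mxE eq_lshift /=.
- by rewrite block_mxEur mxE eq_lrshift.
- by rewrite block_mxEdl mxE eq_rlshift.
- by rewrite block_mxEdr code_mxE eq_rshift /= addKn.
Qed.

Lemma code_mx_nseq m o : code_mx m (nseq m o) = (code_val o)%:M.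
Proof.
by apply/matrixP => i j; rewrite code_mxE mxE nth_nseq ltn_ord.
Qed.

Lemma code_mx_perm m s t :
  size s = m -> perm_eq s t -> code_mx m s =~ code_mx m t.
Proof.
move=> sm; rewrite perm_sym.
rewrite -[s]/(val (Tuple (introT eqP sm))) => /tuple_permP[p tE].
exists (perm_mx p^-1); first exact: unitmx_perm.
rewrite /conj_tr tr_perm_mx map_perm_mx invgK -row_permE -col_permE.
apply/matrixP => i j; rewrite [RHS]mxE [RHS]mxE !code_mxE (inj_eq perm_inj).
congr (code_val _ *+ _); rewrite tE (nth_map i) ?size_enum_ord //.
by rewrite nth_ord_enum (tnth_nth None).
Qed.

(** As long as no entry is a unit, [y] can be taken out of the whole matrix; each time the exponent
    [k] for which divisibility fails drops by one. *)
Lemma factor_uniformiser n k (M : 'M[A]_n) i j : ~ pow_dvd k (M i j) ->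
  exists e (N : 'M_n), M = y ^+ e *: N /\ exists p q, N p q \is a GRing.unit.
Proof.
elim: k M => [|k IH] M hk.
  by case: hk; exists (M i j); rewrite mulr1.
have [[p [q upq]]|nu] := classic (exists p q, M p q \is a GRing.unit).
  by exists 0, M; rewrite scale1r; split=> //; exists p, q.
have /fin_all_exists[N hN] (p : 'I_n * 'I_n) : exists x, M p.1 p.2 = x * y.
  by apply: nonunit_mulr; apply/negP => u; apply: nu; exists p.1, p.2.
pose N' : 'M_n := \matrix_(p, q) N (p, q).
have ME : M = y *: N'.
  by apply/matrixP => p q; rewrite !mxE mulrC (hN (p, q)).
have [|e [P [PE hP]]] := IH N'.
  by move=> [d dE]; apply: hk; exists d; rewrite ME mxE dE exprS; ring.
by exists e.+1, P; rewrite ME PE scalerA -exprS.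
Qed.

(** Induction on the size. After the largest power [y ^+ e] is taken out, division by [c e] leaves a
    hermitian matrix with a unit entry, which splits. Multiplied back by [y ^+ e * c e], the
    complement again has type [eta]. *)
Lemma star_congruent_code_mx n (M : 'M_n) : M^*t = eta *: M ->
  exists2 t, size t = n & M =~ code_mx n t.
Proof.
elim: n M => [|n IH] M hM.
  exists [::] => //; rewrite (thinmx0 M) [code_mx _ _]thinmx0.
  exact: star_congruent_refl.
have [->|/eqP M0] := eqVneq M 0.
  exists (nseq n.+1 None); first by rewrite size_nseq.
  rewrite code_mx_nseq /= raddf0; exact: star_congruent_refl.
have [i [j /ex_not_pow_dvd[k hk]]] : exists i j, M i j != 0.
  apply: NNPP => h; apply: M0; apply/matrixP => i j; rewrite mxE.
  by apply/eqP/negP => /negP h'; apply: h; exists i, j.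
have [e [M1 [ME [p [q upq]]]]] := factor_uniformiser hk.
pose sg : A := (-1) ^+ e.
have sg2 : sg * sg = 1 by rewrite -expr2 sqrr_sign.
have hM1 : M1^*t = (eta * (-1) ^+ e) *: M1.
  apply/matrixP => a a'; apply: (mulfI (expy_neq0 e)).
  move/matrixP: hM => /(_ a a'); rewrite ME !mxE rmorphM rmorphXn hystar.
  rewrite (exprNn y) -/sg => h.
  transitivity (sg * (sg * y ^+ e * star (M1 a' a))); last by rewrite h; ring.
  by rewrite !mulrA sg2 mul1r.
pose H : 'M_(1 + n) := (c e)^-1 *: M1.
have hH : H^*t = H.
  rewrite conj_trZ hM1 scalerA; congr (_ *: _).
  have ku : eta * sg \is a GRing.unit.
    by apply/unitrP; exists (eta * sg); rewrite mulrACA heta sg2 mulr1.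
  by rewrite rmorphV // hcstar invrM // -mulrA mulVr // mulr1.
have uH : H p q \is a GRing.unit by rewrite mxE unitrM unitrV hc.
have [s [H' [hH' HH']]] := hermitian_split hH uH.
pose a := y ^+ e * c e.
have MH : M = a *: H by rewrite /H scalerA /a -mulrA mulrV // mulr1.
have [|t st ht] := IH (a *: H').
  rewrite conj_trZ hH' scalerA; congr (_ *: _).
  rewrite rmorphM rmorphXn hystar hcstar (exprNn y) -/sg /a.
  transitivity (sg * sg * (eta * (y ^+ e * c e))); first by ring.
  by rewrite sg2 mul1r.
(* The parity of the code is the sign [s] and its half is the exponent [e]. *)
exists (Some (s + e.*2)%N :: t); first by rewrite /= st.
rewrite -[_ :: t]cat1s MH.
rewrite -[code_mx n.+1 _]/(code_mx (1 + n) _) code_mx_cat //.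
apply: star_congruent_trans (star_congruentZ a HH') _.
rewrite scale_block_mx !scaler0 -[[:: _]]/(nseq 1 _) code_mx_nseq.
rewrite scale_scalar_mx mulrC /= oddD odd_double addbF half_bit_double.
case: s {HH'}; exact: star_congruent_block.
Qed.

(** * The law of inertia *)

(** A homogeneous system with unknowns indexed by [P] and fewer equations, indexed by [Q], has a
    nonzero solution, which is extended by zero outside [P]. *)
Lemma supported_kernel n (G : 'M[F]_n) (P Q : {set 'I_n}) : (#|Q| < #|P|)%N ->
  exists v : 'cV[F]_n, [/\ v != 0, forall i, i \notin P -> v i 0 = 0 &
    forall j, j \in Q -> (G *m v) j 0 = 0].
Proof.
move=> QP.
pose B : 'M[F]_(#|P|, #|Q|) := \matrix_(i, j) G (enum_val j) (enum_val i).
have : kermx B != 0.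
  rewrite kermx_eq0 /row_free neq_ltn (leq_ltn_trans (rank_leq_col B)) //.
case/rowV0Pn => w /sub_kermxP wB w0.
pose v : 'cV[F]_n := \col_i \sum_(k < #|P|) w 0 k *+ (enum_val k == i).
have vE k : v (enum_val k) 0 = w 0 k.
  rewrite mxE (bigD1 k) //= eqxx mulr1n big1 ?addr0 // => l lk.
  by rewrite (inj_eq enum_val_inj) (negbTE lk).
have v0 i : i \notin P -> v i 0 = 0.
  move=> iP; rewrite mxE big1 // => k _; case: eqP => // ki.
  by case/negP: iP; rewrite -ki enum_valP.
exists v; split=> //.
  apply: contraNneq w0 => vz; apply/eqP/rowP => k.
  by rewrite -vE vz !mxE.
move=> j jQ; rewrite mxE (bigID (mem P)) /= addrC big1 ?add0r => [|i iP]; last first.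
  by rewrite v0 // mulr0.
rewrite big_enum_val /=.
have := congr1 (fun Z : 'rV_ _ => Z 0 (enum_rank_in jQ j)) wB.
rewrite !mxE => wB0; rewrite -[RHS]wB0; apply: eq_bigr => k _.
by rewrite [B _ _]mxE enum_rankK_in // vE mulrC.
Qed.

Lemma code_val_neq0 n : code_val (Some n) != 0.
Proof.
rewrite mulf_neq0 ?signr_eq0 // mulf_neq0 ?expy_neq0 //.
by apply: contraTneq (hc n./2) => ->; rewrite unitr0.
Qed.

Lemma code_val_dvd n k : (n./2 < k./2)%N ->
  exists2 d, code_val (Some k) = code_val (Some n) * d & pi d = 0.
Proof.
move=> nk; pose sg (i : nat) : A := (-1) ^+ odd i.
have sg2 : sg n * sg n = 1 by rewrite -expr2 sqrr_sign.
exists (sg n * sg k * (y ^+ (k./2 - n./2) * (c k./2 / c n./2))).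
  rewrite /= -/(sg n) -/(sg k) -{1}(subnKC (ltnW nk)) exprD.
  transitivity ((sg n * sg n) * (c n./2 / c n./2) *
    (sg k * (y ^+ n./2 * y ^+ (k./2 - n./2) * c k./2))).
    by rewrite sg2 mulrV // !mul1r.
  by set a := _^-1; ring.
rewrite -subnSK // exprS !rmorphM /=.
by have /residue_eq0-> := uniformiser_nonunit; ring.
Qed.

(** The contribution of one entry of a diagonal form to a sum of norms. An entry of smaller
    valuation makes [x] a nonunit, one of larger valuation makes [z] a nonunit, a zero entry makes
    [z = 0], and the entry of opposite sign gives [z = - x], hence minus a norm. *)
Lemma code_val_cases n o x z : o != Some n ->
    code_val o * x = code_val (Some n) * z ->
  exists s t, star x * z = t - star s * s /\ pi t = 0.
Proof.
case: o => [k|] on; last first.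
  rewrite mul0r => /esym/eqP; rewrite mulf_eq0 (negbTE (code_val_neq0 n)) => /eqP->.
  by exists 0, 0; rewrite !mulr0 subrr rmorph0.
have cancel := mulfI (code_val_neq0 n).
have [/code_val_dvd[d dE d0]|/code_val_dvd[d dE d0]|kn] := ltngtP k./2 n./2.
- rewrite dE -mulrA => /(mulfI (code_val_neq0 k)) xE.
  exists 0, (star x * z); split; first by rewrite mulr0 subr0.
  rewrite rmorphM (@residue_star _ 0) ?rmorph0 ?rmorph0 ?mul0r //.
  by rewrite xE rmorphM d0 mul0r.
- rewrite dE -mulrA => /cancel <-.
  exists 0, (star x * (d * x)); split; first by rewrite mulr0 subr0.
  by rewrite !rmorphM d0 mul0r mulr0.
have -> : code_val (Some k) = - code_val (Some n).
  have ok : odd k = ~~ odd n.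
    apply/eqP; apply: contraNT on => /negPf ok; apply/eqP; congr Some.
    by rewrite -(odd_double_half k) -(odd_double_half n) kn; case: odd ok; case: odd.
  by rewrite /= ok kn signrN mulNr.
rewrite mulNr -mulrN => /cancel <-.
by exists x, 0; rewrite rmorph0 mulrN sub0r.
Qed.

(* Write [N], [N'] for the two diagonal forms and [g = +- y^i c_i] for the entry
   with code [n]. If [N] had more entries [g] than [N'], some [v], nonzero modulo
   [y] and supported on the entries [g] of [N], would have coordinates [w] with
   respect to [N'] vanishing modulo [y] on the entries [g] of [N']. Modulo [y],
   the value of the form at [v], divided by [g], is the sum of the norms
   [v_j v_j^*] on one side, and on the other side minus the sum of the norms
   [w_j w_j^*] over the entries [- g] of [N']: the entries of [N'] of larger
   valuation contribute 0, and at those of smaller valuation [w_j] is a nonunit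
   since [N' w = X'^* N v] is divisible by [g]. *)
Lemma inertia_leq m s t n : code_mx m s =~ code_mx m t ->
  (#|[set j : 'I_m | nth None s j == Some n]| <=
   #|[set j : 'I_m | nth None t j == Some n]|)%N.
Proof.
set P := [set j | _]; set Q := [set j | _] => -[X uX tE].
rewrite leqNgt; apply/negP => /(supported_kernel (map_mx pi (invmx X)))[v].
case=> v0 vP vQ.
(* Zero coordinates outside [P] are lifted to 0 itself, so that the lift [V] is an exact eigenvector
   of [code_mx m s], not only modulo [y]. *)
have /fin_all_exists[lv lvE] i : exists a, pi a = v i 0 /\ (i \notin P -> a = 0).
  have [iP|iP] := boolP (i \in P); last by exists 0; rewrite rmorph0 vP.
  by have [a aE] := residue_surj (v i 0); exists a.
pose V : 'cV[A]_m := \col_i lv i; pose W := invmx X *m V.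
set g := code_val (Some n).
have sV : code_mx m s *m V = g *: V.
  apply/matrixP => i j; rewrite ord1 mul_diag_mx !mxE.
  have [|/(lvE i).2->] := boolP (i \in P); last by rewrite !mulr0.
  by rewrite inE => /eqP->.
have tW : code_mx m t *m W = g *: (X^*t *m V).
  by rewrite tE -!mulmxA [X *m W]mulKVmx // sV scalemxAr.
have sum_norm : W^*t *m (X^*t *m V) = V^*t *m V.
  by rewrite mulmxA -conj_trM [X *m W]mulKVmx.
pose Z := X^*t *m V.
have hW j : j \in Q -> pi (W j 0) = 0.
  by move=> /vQ <-; rewrite !mxE rmorph_sum; apply: eq_bigr => i _;
     rewrite !mxE rmorphM (lvE i).1.
have /fin_all_exists[a haW] j :
    exists a, pi (star (W j 0) * Z j 0) = - pi (a * star a).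
  have tj : code_val (nth None t j) * W j 0 = g * Z j 0.
    by move/matrixP: tW => /(_ j 0); rewrite mul_diag_mx !mxE => ->.
  have [jQ|jQ] := boolP (j \in Q).
    exists 0; rewrite mul0r rmorph0 oppr0 rmorphM (@residue_star _ 0).
      by rewrite rmorph0 rmorph0 mul0r.
    by rewrite rmorph0 hW.
  move: jQ; rewrite inE => jQ.
  have [a [r [-> r0]]] := code_val_cases jQ tj.
  by exists a; rewrite rmorphB r0 sub0r mulrC.
have sum0 : \sum_(i : 'I_m) pi (lv i * star (lv i)) +
            \sum_(i : 'I_m) pi (a i * star (a i)) = 0.
  move/matrixP: sum_norm => /(_ 0 0); rewrite mxE [RHS]mxE => /(congr1 pi).
  rewrite !rmorph_sum /= => h; rewrite -[X in _ + X]opprK -sumrN.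
  rewrite -(eq_bigr _ (fun j _ => haW j)); apply/eqP; rewrite subr_eq0.
  apply/eqP; transitivity (\sum_i pi (V^*t 0 i * V i 0)).
    by apply: eq_bigr => i _; rewrite !mxE mulrC.
  by rewrite -h; apply: eq_bigr => i _; congr (pi (_ * _)); rewrite !mxE.
(* Both sums form one sum of norms over a disjoint union, so anisotropy makes every [lv i] vanish
   modulo [y], against [v != 0]. *)
pose x (o : 'I_m + 'I_m) := match o with inl i => lv i | inr i => a i end.
have hx : \sum_(o <- enum {: 'I_m + 'I_m}) pi (x o * star (x o)) = 0.
  by rewrite big_enum big_sumType.
case/eqP: v0; apply/matrixP => i j; rewrite ord1 mxE -(lvE i).1.
exact: (residue_norm_sum_eq0 hx (mem_enum _ (inl i))).
Qed.

Lemma count_mem_card m (s : seq (option nat)) n : size s = m ->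
  count_mem (Some n) s = #|[set j : 'I_m | nth None s j == Some n]|.
Proof.
move=> <-; rewrite -sum1_count (big_nth None) big_mkord -sum1_card.
by apply: eq_bigl => i; rewrite inE.
Qed.

(** * Uniqueness and the passage to block diagonal normal forms *)

(** This is the order of the diagonal entries in a normal form: increasing powers of [y], plus
    before minus, zeros last. *)
Definition code_le (o p : option nat) : bool :=
  match o, p with
  | _, None => true
  | None, Some _ => false
  | Some i, Some j => (i <= j)%N
  end.

Lemma code_le_trans : transitive code_le.
Proof. by move=> [j|] [i|] [k|] //=; apply: leq_trans. Qed.

Lemma code_le_anti : antisymmetric code_le.
Proof. by move=> [i|] [j|] //=; rewrite -eqn_leq => /eqP->. Qed.

(** Inertia counts only the nonzero entries; the equal sizes then fix the number of zeros. *)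
Lemma perm_eq_codes (s t : seq (option nat)) : size s = size t ->
    (forall n, count_mem (Some n) s = count_mem (Some n) t) -> perm_eq s t.
Proof.
move=> st hst.
have hN (r : seq (option nat)) :
    (count_mem None r + size (pmap id r))%N = size r.
  by elim: r => [|[n|] r IH] //=; rewrite -IH ?addnS.
have hS n (r : seq (option nat)) : count_mem n (pmap id r) = count_mem (Some n) r.
  by elim: r => [|[p|] r IH] //=; rewrite IH.
have : perm_eq (pmap id s) (pmap id t).
  by apply/allP => n _; rewrite /= !hS hst.
move=> /perm_size hp; apply/allP => -[n|] _ /=; first by rewrite hst.
by rewrite -(eqn_add2r (size (pmap id s))) {2}hp !hN st.
Qed.

Lemma code_mx_uniq m (s t : seq (option nat)) : size s = m -> size t = m ->
    sorted code_le s -> sorted code_le t -> code_mx m s =~ code_mx m t ->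
  s = t.
Proof.
move=> sm tm ss st h; apply: (sorted_eq code_le_trans code_le_anti ss st).
apply: perm_eq_codes => [|n]; first by rewrite sm tm.
apply/eqP; rewrite !(@count_mem_card m) // eqn_leq !inertia_leq //.
exact: star_congruent_sym.
Qed.

Definition block_codes k (p q : 'I_k -> nat) (z : nat) : seq (option nat) :=
  flatten [seq nseq (p i) (Some i.*2) ++ nseq (q i) (Some i.*2.+1) | i <- enum 'I_k]
    ++ nseq z None.

Lemma block_codes_sorted k (p q : 'I_k -> nat) z :
  sorted code_le (block_codes p q z).
Proof.
rewrite (sorted_pairwise code_le_trans) /block_codes pairwise_cat.
have nseq_pairwise r o : pairwise code_le (nseq r o).
  elim: r => //= r ->; rewrite andbT; apply/allP => _ /nseqP[-> _].
  by case: o => /=.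
rewrite nseq_pairwise andbT; apply/andP; split.
  by apply/allrelP => -[n|] o _ /nseqP[-> _].
have : pairwise (fun i j : 'I_k => (i < j)%N) (enum 'I_k).
  rewrite -(pairwise_map val ltn) val_enum_ord -sorted_pairwise.
    exact: iota_ltn_sorted.
  exact: ltn_trans.
elim: (enum 'I_k) => //= i r IH /andP[/allP ir /IH hr].
rewrite pairwise_cat hr andbT; apply/andP; split.
  apply/allrelP => o o' ho /flatten_mapP[j /ir ij ho'].
  move: ho ho'; rewrite !mem_cat => /orP[]/nseqP[-> _] /orP[]/nseqP[-> _] /=; lia.
rewrite pairwise_cat !nseq_pairwise !andbT.
by apply/allrelP => o o' /nseqP[-> _] /nseqP[-> _] /=.
Qed.

Lemma castmx_code_mx m n (e : m = n) t :
  castmx (e, e) (code_mx m t) = code_mx n t.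
Proof. by subst n; rewrite castmx_id. Qed.

Lemma mxdiag_code_mx k (r : 'I_k -> nat) (t : 'I_k -> seq (option nat)) :
    (forall i, size (t i) = r i) ->
  \mxdiag_i code_mx (r i) (t i) =
    code_mx (\sum_i r i) (flatten [seq t i | i <- enum 'I_k]).
Proof.
elim: k r t => [|k IH] r t ht.
  by apply/matrixP => -[i hi]; exfalso; move: hi; rewrite big_ord0.
rewrite mxdiag_recl (IH (fun i => r (lift ord0 i)) (fun i => t (lift ord0 i))) //.
by rewrite -code_mx_cat // castmx_code_mx enum_ordSl /= -map_comp.
Qed.

Lemma block_codesE m k (p q : 'I_k -> nat) z
    (e : (\sum_(i < k) (p i + q i) + z)%N = m) :
  castmx (e, e) (block_mx (\mxdiag_(i < k) (y ^+ i *: pm_diag (c i) (p i) (q i)))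
                    0 0 (0 : 'M[A]_z)) = code_mx m (block_codes p q z) /\
  size (block_codes p q z) = m.
Proof.
pose t (i : 'I_k) := nseq (p i) (Some i.*2) ++ nseq (q i) (Some i.*2.+1).
have st i : size (t i) = (p i + q i)%N by rewrite size_cat !size_nseq.
have sf : size (flatten [seq t i | i <- enum 'I_k]) = (\sum_(i < k) (p i + q i))%N.
  rewrite size_flatten /shape -map_comp sumnE big_map big_enum /=.
  exact: eq_bigr.
split; last by rewrite size_cat sf size_nseq.
rewrite -[RHS](castmx_code_mx e); congr castmx.
have blockE (i : 'I_k) : y ^+ i *: pm_diag (c i) (p i) (q i) = code_mx (p i + q i) (t i).
  rewrite code_mx_cat ?size_nseq // !code_mx_nseq scale_block_mx !scaler0.
  by rewrite !scale_scalar_mx /= odd_double doubleK mul1r uphalf_double mulN1r mulrN.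
rewrite code_mx_cat; last exact: sf.
by rewrite code_mx_nseq raddf0 -(mxdiag_code_mx st) (eq_mxdiag blockE).
Qed.

(** It reduces the uniqueness of the normal form to that of a sorted list of codes, with no
    reference to block sizes or casts. *)
Lemma diagonal_form_sorted m (N : 'M[A]_m) : diagonal_form y c N ->
  exists t, [/\ size t = m, sorted code_le t & N = code_mx m t].
Proof.
move=> [k [p [q [z [e ->]]]]]; have [-> st] := block_codesE e.
by exists (block_codes p q z); split=> //; apply: block_codes_sorted.
Qed.

Lemma perm_block_codes (t : seq (option nat)) :
  exists k (p q : 'I_k -> nat) z, perm_eq t (block_codes p q z).
Proof.
(* This [k] exceeds every code in [t], hence every exponent of [y] that occurs; the block sizes are
   the multiplicities of the codes. *)
pose k := (\max_(o <- t) odflt 0 o).+1.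
pose p (i : 'I_k) := count_mem (Some i.*2) t.
pose q (i : 'I_k) := count_mem (Some i.*2.+1) t.
exists k, p, q, (count_mem None t); apply/allP => o _; apply/eqP => /=.
have cE : count_mem o (block_codes p q (count_mem None t)) =
    (\sum_(i < k) ((Some i.*2 == o) * p i + (Some i.*2.+1 == o) * q i) +
     (None == o) * count_mem None t)%N.
  rewrite count_cat count_nseq count_flatten -map_comp sumnE big_map big_enum /=.
  by congr (_ + _)%N; apply: eq_bigr => i _; rewrite count_cat !count_nseq.
rewrite cE; case: o {cE} => [n|]; last by rewrite mul1n big1.
rewrite mul0n addn0 -(odd_double_half n); move: (odd n) n./2 => e h.
have evenE i : (Some i.*2 == Some (e + h.*2)%N) = ~~ e && (i == h).
  by rewrite (inj_eq Some_inj); case: (e) => /=; lia.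
have oddE i : (Some i.*2.+1 == Some (e + h.*2)%N) = e && (i == h).
  by rewrite (inj_eq Some_inj); case: (e) => /=; lia.
under eq_bigr do rewrite evenE oddE.
have [hk|kh] := ltnP h k.
  rewrite (bigD1 (Ordinal hk)) //= big1 => [|i].
    by rewrite eqxx /p /q; case: (e) => /=; rewrite mul1n mul0n !addn0.
  by rewrite -val_eqE /= => /negPf->; rewrite !andbF.
rewrite big1 => [|i _]; last first.
  by rewrite (ltn_eqF (leq_trans (ltn_ord i) kh)) !andbF.
apply/count_memPn/negP => ot; move: kh; rewrite leqNgt ltnS => /negP; apply.
have : (odflt 0 (Some (e + h.*2)) <= \max_(o <- t) odflt 0 o)%N.
  exact: (@leq_bigmax_seq _ t xpredT (odflt 0%N)).
by case: (e) => /=; lia.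
Qed.

Lemma normal_form_exists_unique m (M : 'M[A]_m) : M^*t = eta *: M ->
  exists! N : 'M[A]_m, diagonal_form y c N /\ M =~ N.
Proof.
move=> /star_congruent_code_mx[t st Mt].
have [k [p [q [z tb]]]] := perm_block_codes t.
have e : (\sum_(i < k) (p i + q i) + z)%N = m.
  (* Taken at the sum of the block sizes itself, where the cast is trivial, the size statement
     yields the equation needed for the cast to [m]. *)
  have [_ <-] := @block_codesE _ k p q z erefl.
  by rewrite -(perm_size tb).
have [NE sN] := block_codesE e.
have MN := star_congruent_trans Mt (code_mx_perm st tb).
exists (code_mx m (block_codes p q z)); split.
  by split=> //; exists k, p, q, z, e; rewrite NE.
move=> N' [/diagonal_form_sorted[t' [st' ss' ->]] MN'].
congr code_mx; apply: code_mx_uniq sN st' (block_codes_sorted p q z) ss' _.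
exact: star_congruent_trans (star_congruent_sym MN) MN'.
Qed.

End HermitianForms.

Theorem theorem9 (A : idomainType) (hDVR : is_DVR A) (hcomplete : adic_complete A)
    (h2 : (2%:R : A) \is a GRing.unit)
    (F : fieldType) (pi : {rmorphism A -> F}) (hpi : residue_map pi)
    (hF : quadratically_closed F)
    (star : {rmorphism A -> A}) (hstar : involutive star)
    (hunram : unramified pi star)
    (y : A) (hy : uniformiser y) (hystar : star y = - y)
    (b : A) (hb : b \is a GRing.unit) (hbstar : star b = - b)
    (m : nat) (hm : (0 < m)%N) (M : 'M[A]_m) :
  (hermitian_mx star M ->
     exists! N : 'M[A]_m,
       diagonal_form y (hermitian_scalar b) N /\ star_congruent star M N) /\
  (skew_hermitian_mx star M ->
     exists! N : 'M[A]_m,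
       diagonal_form y (skew_hermitian_scalar b) N /\ star_congruent star M N).
Proof.
have nf :=
  normal_form_exists_unique hDVR hy hcomplete h2 hpi hF hstar hystar hb hbstar.
(* The hermitian case is [eta = 1], the skew hermitian case [eta = -1]; what remains is to check the
   types of the scalars by the parity of [i]. *)
split=> hM; [apply: (nf _ 1) => [i||i|] | apply: (nf _ (-1)) => [i||i|]].
- by rewrite /hermitian_scalar; case: odd; rewrite ?unitr1.
- by rewrite mulr1.
- rewrite /hermitian_scalar mul1r -signr_odd.
  by case: odd; rewrite ?hbstar ?rmorph1 ?expr1 ?mulN1r ?mulr1.
- by rewrite scale1r.
- by rewrite /skew_hermitian_scalar; case: odd; rewrite ?unitr1.
- by rewrite mulrNN mulr1.
- rewrite /skew_hermitian_scalar mulN1r -signr_odd.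
  by case: odd; rewrite ?hbstar ?rmorph1 ?expr1 ?opprK ?mulr1 ?mulN1r.
- by rewrite scaleN1r.
Qed.
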